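(* Let $n,k$ be integers with $n-2\geq k\geq 0$. Let $S_k(2,1;n)$ be the number of standard Young tableaux whose shape is a partition of $n$ of the form $(\lambda_1,\lambda_2,1^{n-\lambda_1-\lambda_2})$ with $\lambda_1-\lambda_2=k$. Then $$S_k(2,1;n)=(-1)^{n+k}+\sum_{i=0}^{\lfloor\frac{n-k-1}{2}\rfloor}\sum_{j=0}^{n-k-1-2i}\chi(j\equiv n+k-1 \pmod 2)\,\frac{2k+2}{n+k+1-2i-j}\binom{n-2i-2}{j}\binom{n-2i-j-1}{(n+k-j-1)/2-i},$$ where $\chi(\cdot)$ equals $1$ if the condition holds and $0$ otherwise.
   Context: A partition $(\lambda_1,\lambda_2,1^{m})$ denotes the partition with parts $\lambda_1\geq\lambda_2\geq 1\geq\cdots$, with $m$ trailing parts equal to $1$ (here $\lambda_2$ may be $0$, in which case $m=0$). These are exactly the partitions lying in the $(2,1)$-hook, i.e. partitions with $\lambda_3\leq 1$. *)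

(* Defs.v *)
From HB Require Import structures.
From mathcomp Require Import all_boot all_order all_algebra.

Set Implicit Arguments.
Unset Strict Implicit.
Unset Printing Implicit Defensive.

(* Parts are indexed from 0, so that lambda_i is [part la i.-1]; indices past
   the end give 0. *)
Definition part (n : nat) (la : n.-tuple 'I_n.+1) (i : nat) : nat :=
  nth 0 (map val la) i.

(* A partition of n has at most n parts, all at most n; it is represented by its
   sequence of parts padded with zeros to length n. *)
Definition is_partition (n : nat) (la : n.-tuple 'I_n.+1) : bool :=
  sorted geq (map val la) && (sumn (map val la) == n).

(* la = (la_1, la_2, 1^(n - la_1 - la_2)), followed by zeros. *)
Definition hook21 (n : nat) (la : n.-tuple 'I_n.+1) : bool :=
  [forall i : 'I_n, (2 <= i) ==>
     (part la i == if i < 2 + (n - part la 0 - part la 1) then 1 else 0)].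

(* The cells (row, column) of the Young diagram of la. *)
Definition cell (n : nat) (la : n.-tuple 'I_n.+1) : finType :=
  {c : 'I_n * 'I_n | c.2 < part la c.1}.

(* A filling T has entries in {0, .., n-1} instead of {1, .., n}. When la is a
   partition of n there are n cells, so an injective filling uses each entry
   exactly once. *)
Definition standard (n : nat) (la : n.-tuple 'I_n.+1)
    (T : {ffun cell la -> 'I_n}) : bool :=
  [&& injectiveb T,
      [forall c : cell la, forall d : cell la,
         ((val c).1 == (val d).1) && ((val c).2 < (val d).2) ==> (T c < T d)] &
      [forall c : cell la, forall d : cell la,
         ((val c).2 == (val d).2) && ((val c).1 < (val d).1) ==> (T c < T d)]].

Definition SYT (n : nat) (la : n.-tuple 'I_n.+1) : {set {ffun cell la -> 'I_n}} :=
  [set T | standard T].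

(* S_k(2,1;n) *)
Definition S21 (k n : nat) : nat :=
  \sum_(la : n.-tuple 'I_n.+1 |
        [&& is_partition la, hook21 la & part la 0 - part la 1 == k])
     #|SYT la|.

(* chi(b) as a rational number. *)
Definition chi (b : bool) : rat := (b : nat)%:R%R.

(* Main.v *)
(* Recording, for each entry of a standard tableau of hook shape, the row it lies
   in (identifying all rows from the third on) turns the tableau into a word on
   {0, 1, 2} of which every prefix has a hook shape as content. The number W(n, k)
   of such words with #0 - #1 = k satisfies
     W(n + 1, k) = W(n, k - 1) + W(n, k) + W(n, k + 1) - [k = n],
   a Motzkin recurrence. The inner sum of the formula is a number of Motzkin paths
   with n - 2i - 1 steps and a nonlevel first step, expanded by its number j of
   level steps with ballot numbers for the others; the outer sum over
   i satisfies the same recurrence, up to the sign (-1)^n at k = 0 that is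
   compensated by (-1)^(n + k). *)
Require Import Defs.
From mathcomp Require Import all_boot all_order all_algebra.
From mathcomp Require Import zify ring.
Import GRing.Theory Num.Theory.

Set Implicit Arguments.
Unset Strict Implicit.
Unset Printing Implicit Defensive.

(** * Ballot and Motzkin numbers *)

Local Open Scope ring_scope.

Definition motzkin_step (f : nat -> rat) (k : nat) : rat :=
  (if k is k'.+1 then f k' else 0) + f k + f k.+1.

(* Number of paths with q steps +1 or -1 from 0 to k that never go below 0,
   by the reflection principle. *)
Definition ballot (q k : nat) : rat :=
  if odd (q + k) then 0
  else 'C(q, (q + k)./2)%:R - 'C(q, (q + k)./2.+1)%:R.

Lemma ballot0 (k : nat) : ballot 0 k = (k == 0%N)%:R.
Proof.
rewrite /ballot add0n; case: k => [|[|k]] //=.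
by rewrite negbK; case: (odd k); rewrite ?subrr.
Qed.

Lemma ballotS (q k : nat) :
  ballot q.+1 k = (if k is k'.+1 then ballot q k' else 0) + ballot q k.+1.
Proof.
rewrite /ballot addSn addnS; case: ifP => Ho.
  case: k Ho => [|k] Ho; first by rewrite addr0.
  by move: Ho; rewrite addnS /= negbK => ->; rewrite addr0.
have [s Hs] : exists s, (q + k)%N = s.*2.+1.
  by exists (q + k)./2; rewrite -[LHS]odd_double_half -[odd _]negbK; rewrite /= in Ho; rewrite Ho.
have -> : (q + k).+1./2 = s.+1 by lia.
rewrite !binS !natrD; case: k Ho Hs => [|k] Ho Hs.
  (* At height 0 no step arrives from below; the symmetry of row [q = 2s + 1] of Pascal's triangle
     accounts for the missing term. *)
  have -> : 'C(q, s.+1) = 'C(q, s).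
    by rewrite -[RHS]bin_sub; [congr 'C(_, _)|]; lia.
  ring.
have E : (q + k)%N = s.*2 by lia.
rewrite E odd_double doubleK; ring.
Qed.

(** With [q + k = 2s], the ratio [(q - s) / (s + 1)] of the two binomials turns their difference
    into the factor [(k + 1) / (s + 1)]. *)
Lemma ballot_closed (q k : nat) : (k <= q)%N -> ~~ odd (q + k) ->
  ballot q k = (2 * k + 2)%:R / (q + k + 2)%:R * 'C(q, (q + k)./2)%:R.
Proof.
move=> kq ev; rewrite /ballot (negbTE ev).
have [s Hs] : exists s, (q + k)%N = s.*2.
  by exists (q + k)./2; rewrite -[LHS]odd_double_half (negbTE ev).
rewrite Hs doubleK.
have Hk : (k%:R : rat) = s%:R * 2 - q%:R.
  by rewrite -(natrM _ s 2) muln2 -Hs natrD addrC addKr.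
have -> : ((s.*2 + 2)%:R : rat) = s.+1%:R * 2.
  by rewrite -(natrM _ s.+1 2); congr _%:R; lia.
have /(congr1 (fun x => x%:R : rat)) := mul_bin_left q s.
rewrite !natrM natrB; last by lia.
move=> H.
have s0 : (s.+1%:R : rat) != 0 by rewrite pnatr_eq0.
have -> : ('C(q, s.+1)%:R : rat) = (q%:R - s%:R) * 'C(q, s)%:R / s.+1%:R.
  by rewrite -H mulrC mulKf.
rewrite natrD natrM Hk; rewrite -[s.+1]addn1 natrD in s0 *.
by field.
Qed.

Lemma ballot_eq0 (q k : nat) : (q < k)%N -> ballot q k = 0.
Proof.
move=> qk; rewrite /ballot; case: ifP => // Ho.
by rewrite !bin_small ?subrr //; lia.
Qed.

(* Number of Motzkin paths with m steps from height 1 to height k, equivalently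
   of those with m + 1 steps from 0 to k whose first step is not level; j counts
   the level steps. *)
Definition motzkin_from1 (m k : nat) : rat :=
  \sum_(0 <= j < m.+1) 'C(m, j)%:R * ballot (m.+1 - j) k.

Lemma motzkin_from1_0 (k : nat) : motzkin_from1 0 k = (k == 1%N)%:R.
Proof.
rewrite /motzkin_from1 big_nat1 bin0 mul1r subn0 ballotS.
by case: k => [|k]; rewrite !ballot0 ?add0r ?addr0.
Qed.

(** Pascal's rule on ['C(m.+1, j)] gives one sum equal to [motzkin_from1 m k] (a level step) and one
    in which every ballot number has one more step, so that [ballotS] applies. *)
Lemma motzkin_from1S (m k : nat) :
  motzkin_from1 m.+1 k = motzkin_step (motzkin_from1 m) k.
Proof.
rewrite {1}/motzkin_from1 big_nat_recl // bin0 mul1r subn0.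
under eq_bigr => j _ do rewrite binS natrD mulrDl subSS.
rewrite big_split /= addrA [X in X + _ = _](_ : _ =
  \sum_(0 <= j < m.+1) 'C(m, j)%:R * ballot (m.+1 - j).+1 k); last first.
  rewrite [RHS]big_nat_recl // bin0 mul1r subn0; congr (_ + _).
  rewrite big_nat_recr //= bin_small // mul0r addr0.
  apply: eq_big_nat => j /andP[_ jm]. by congr (_ * ballot _ _); lia.
under [X in X + _ = _]eq_bigr => j _ do rewrite ballotS mulrDr.
rewrite big_split /= /motzkin_step /motzkin_from1 addrAC.
by case: k => [|k] //; congr (_ + _ + _); rewrite big1 // => j _; rewrite mulr0.
Qed.

(* Number of Motzkin paths with N - 1 steps from 0 to k whose first step is not
   level; N - 1 is meant in the integers, so the value is 0 for N = 0. *)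
Definition motzkin_nonlevel (N k : nat) : rat :=
  match N with
  | 0 => 0
  | 1 => (k == 0%N)%:R
  | m.+2 => motzkin_from1 m k
  end.

Lemma motzkin_nonlevel_eq0 (N k : nat) : (N <= k)%N -> motzkin_nonlevel N k = 0.
Proof.
case: N => [|[|m]] //=; first by case: k.
move=> mk; rewrite /motzkin_from1 big_nat big1 // => j _.
by rewrite ballot_eq0 ?mulr0 //; lia.
Qed.

(** Both corrections concern the empty path: it enters at index 1 without a predecessor, and its
    level extension is excluded at index 2. *)
Lemma motzkin_nonlevelS (N k : nat) :
  motzkin_nonlevel N.+1 k = motzkin_step (motzkin_nonlevel N) k + ((k == 0%N) && (N == 0%N))%:R - ((k == 0%N) && (N == 1%N))%:R.
Proof.
rewrite /motzkin_step; case: N => [|[|m]] /=; last 1 first.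
- by rewrite !andbF addr0 subr0 motzkin_from1S.
- by case: k => [|k]; rewrite ?motzkin_from1_0 //=; ring.
- by rewrite motzkin_from1_0; case: k => [|[|k]] //=; ring.
Qed.

(** The range of [i] is independent of [k], so that the recurrence acts term by term; the terms
    beyond the range of the stated formula vanish. *)
Definition motzkin_nonlevel_sum (n k : nat) : rat :=
  \sum_(0 <= i < (n./2).+1) motzkin_nonlevel (n - i.*2) k.

Lemma motzkin_nonlevel_sumSS (n k : nat) : motzkin_nonlevel_sum n.+2 k = motzkin_nonlevel n.+2 k + motzkin_nonlevel_sum n k.
Proof.
rewrite /motzkin_nonlevel_sum big_nat_recl //; congr (_ + _).
Qed.

(** Induction in steps of two: the corrections of [motzkin_nonlevelS] occur only at the two start
    values, as +1 and -1, and are then inherited with period 2. *)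
Lemma motzkin_nonlevel_sumS (n k : nat) :
  motzkin_nonlevel_sum n.+1 k = motzkin_step (motzkin_nonlevel_sum n) k + (-1) ^+ n * (k == 0%N)%:R.
Proof.
elim/ltn_ind: n k => -[|[|n]] IH k.
- rewrite /motzkin_step /motzkin_nonlevel_sum !big_nat1 /= expr0 mul1r.
  by case: k => [|k]; rewrite ?big_nat1 !addr0 ?add0r.
- rewrite /motzkin_step /motzkin_nonlevel_sum !big_nat_recl // !big_geq //= motzkin_from1_0.
  by case: k => [|[|k]]; rewrite ?big_nat1 //=; ring.
rewrite motzkin_nonlevel_sumSS IH; last by lia.
rewrite motzkin_nonlevelS /= !andbF /motzkin_step !motzkin_nonlevel_sumSS.
by rewrite !exprS; case: k => [|k]; rewrite ?motzkin_nonlevel_sumSS /=; ring.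
Qed.

Lemma motzkin_nonlevel_sum_eq0 (n k : nat) : (n <= k)%N -> motzkin_nonlevel_sum n k = 0.
Proof. by move=> nk; rewrite /motzkin_nonlevel_sum big1 // => i _; apply: motzkin_nonlevel_eq0; lia. Qed.

(* The right-hand side satisfies the recurrence without the term
   [(k == n)%:R]; that term only affects entries with [k >= n], so the two
   sides agree once their values at [k = n] and [k = n - 1] do. *)
Lemma motzkin_recurrence_solution (W : nat -> nat -> rat) :
  (forall k, W 0%N k = (k == 0%N)%:R) ->
  (forall n k, W n.+1 k = motzkin_step (W n) k - (k == n)%:R) ->
  forall n k, (k <= n)%N -> W n k = (-1) ^+ (n + k) + motzkin_nonlevel_sum n k.
Proof.
move=> W0 WS.
have Wgt n : forall k, (n < k)%N -> W n k = 0.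
  elim: n => [|n IH] k nk; first by rewrite W0; case: k nk.
  rewrite WS /motzkin_step; case: k nk => // k nk.
  by rewrite !IH ?gtn_eqF ?subr0 ?addr0 //; lia.
have Wdiag n : W n n = 1.
  elim: n => [|n IH]; first by rewrite W0.
  by rewrite WS /motzkin_step IH !Wgt ?gtn_eqF ?subr0 ?addr0.
have Wsub n : W n.+1 n = 0.
  elim: n => [|n IH]; rewrite WS /motzkin_step Wdiag eqxx ?IH.
    by rewrite (Wgt 0%N) // add0r addr0 subrr.
  by rewrite (Wgt n.+1) // add0r addr0 subrr.
have Asub n : motzkin_nonlevel_sum n.+1 n = 1.
  elim: n => [|n IH]; rewrite motzkin_nonlevel_sumS /motzkin_step.
    by rewrite !motzkin_nonlevel_sum_eq0 // mul1r !add0r.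
  by rewrite IH (motzkin_nonlevel_sum_eq0 (leqnn _)) (motzkin_nonlevel_sum_eq0 (leqnSn _)) mulr0 !addr0.
elim=> [|n IH] k kn.
  have -> : k = 0%N by lia.
  by rewrite W0 motzkin_nonlevel_sum_eq0.
have [kn'|nk] := ltnP k n; last first.
  have [->|->] : k = n.+1 \/ k = n by lia.
    by rewrite Wdiag motzkin_nonlevel_sum_eq0 // addr0 addnn -signr_odd odd_double.
  by rewrite Wsub Asub addSn addnn -signr_odd /= odd_double addNr.
rewrite WS motzkin_nonlevel_sumS /motzkin_step ltn_eqF // !IH; try lia.
(* For [k > 0] the three neighbouring signs add up to [(-1) ^+ (n.+1 + k)]. For [k = 0] only two
   occur and they cancel, as do the new sign and the correction of [motzkin_nonlevel_sumS]. *)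
case: k kn kn' => [|k] kn kn'; first by rewrite /= !addn0 !addn1 !exprS; ring.
by rewrite IH ?addnS ?addSn /= ?exprS; last lia; ring.
Qed.

(** * Comparison with the closed formula *)

Lemma motzkin_nonlevel_formula (N k : nat) : (k < N)%N ->
  motzkin_nonlevel N k = \sum_(0 <= j < N - k)
     chi (j == N + k - 1 %[mod 2])%N *
         ((2 * k + 2)%N%:R / (N + k + 1 - j)%N%:R) *
         'C(N - 2, j)%:R *
         'C(N - j - 1, (N + k - j - 1) %/ 2)%:R.
Proof.
move=> kN.
(* [chi] selects the parity for which [ballot] is given by binomials; there the summand is
   [ballot_closed]. *)
have E j : (j < N - k)%N -> chi (j == N + k - 1 %[mod 2])%N *
         ((2 * k + 2)%N%:R / (N + k + 1 - j)%N%:R) *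
         'C(N - 2, j)%:R *
         'C(N - j - 1, (N + k - j - 1) %/ 2)%:R = 'C(N - 2, j)%:R * ballot (N - 1 - j) k.
  move=> jN; have [ev|od] := boolP (odd (N - 1 - j + k)).
    have -> : (j == N + k - 1 %[mod 2])%N = false by lia.
    by rewrite /ballot ev /chi !mul0r mulr0.
  rewrite ballot_closed //; last lia.
  have -> : (j == N + k - 1 %[mod 2])%N by lia.
  rewrite /chi mul1r.
  have -> : (N + k + 1 - j = N - 1 - j + k + 2)%N by lia.
  have -> : (N + k - j - 1 = N - 1 - j + k)%N by lia.
  by rewrite subnAC divn2 [LHS]mulrAC mulrC.
rewrite [RHS](eq_big_nat _ _ (F2 := fun j => 'C(N - 2, j)%:R * ballot (N - 1 - j) k)); last first.
  by move=> j /andP[_ jN]; exact: E.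
case: N kN {E} => [|[|m]] // kN.
  (* For [N = 1] the truncated [N - 2] is 0, and the single term ['C(0, 0) * ballot 0 0 = 1] is the
     empty path. *)
  have -> : k = 0%N by lia.
  by rewrite big_nat1 ballot0 mulr1.
rewrite /= /motzkin_from1 subn2 /=.
have Z j : (m.+2 - k <= j)%N -> 'C(m, j)%:R * ballot (m.+2 - 1 - j) k = 0.
  case: (leqP j m.+1) => jm H; last by rewrite bin_small ?mul0r //; lia.
  case: (ltnP m j) => H2; first by rewrite bin_small ?mul0r //.
  by rewrite ballot_eq0 ?mulr0 //; lia.
(* The zero term [j = m + 1] is added so that the cut at [m.+2 - k] lies in the range even for
   [k = 0]. *)
have -> : \sum_(0 <= j < m.+1) 'C(m, j)%:R * ballot (m.+1 - j) k =
          \sum_(0 <= j < m.+2) 'C(m, j)%:R * ballot (m.+2 - 1 - j) k.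
  rewrite [RHS]big_nat_recr //= bin_small // mul0r addr0.
  by apply: eq_big_nat => j _; rewrite subn1.
rewrite (@big_cat_nat _ _ _ (m.+2 - k)) //=; last lia.
rewrite [X in _ + X]big_nat [X in _ + X]big1 ?addr0 // => j /andP[H _].
exact: Z.
Qed.

Lemma motzkin_nonlevel_sum_formula (n k : nat) : (k < n)%N ->
  motzkin_nonlevel_sum n k =
     \sum_(0 <= i < (((n - k - 1) %/ 2).+1)%N)
       \sum_(0 <= j < ((n - k - 1 - 2 * i).+1)%N)
         chi (j == n + k - 1 %[mod 2])%N *
         ((2 * k + 2)%N%:R / (n + k + 1 - 2 * i - j)%N%:R) *
         'C(n - 2 * i - 2, j)%:R *
         'C(n - 2 * i - j - 1, (n + k - j - 1) %/ 2 - i)%:R.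
Proof.
move=> kn; rewrite /motzkin_nonlevel_sum (@big_cat_nat _ _ _ ((n - k - 1) %/ 2).+1) //=; last lia.
rewrite [X in _ + X]big_nat [X in _ + X]big1 ?addr0; last first.
  by move=> i Hi; apply: motzkin_nonlevel_eq0; lia.
apply: eq_big_nat => i Hi; rewrite motzkin_nonlevel_formula; last lia.
have -> : (n - i.*2 - k = (n - k - 1 - 2 * i).+1)%N by lia.
apply: eq_big_nat => j Hj.
by congr (chi _ * (_ / _%:R) * 'C(_, _)%:R * 'C(_, _)%:R); lia.
Qed.

Local Close Scope ring_scope.

(** * Hook words *)

Definition admissible (u : seq nat) : bool :=
  (count_mem 1 u <= count_mem 0 u) && ((0 < count_mem 2 u) ==> (0 < count_mem 1 u)).

(* Reading w_v as the row (with rows from the third on identified) of the entry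
   v, every prefix of a hook word describes a partition with lambda_3 <= 1. *)
Definition hook_word (s : seq nat) : bool :=
  all (fun t => admissible (take t s)) (iota 0 (size s).+1).

Lemma hook_wordP (s : seq nat) :
  reflect (forall t, admissible (take t s)) (hook_word s).
Proof.
apply: (iffP allP) => H t; last by move=> _; apply: H.
have [ts|st] := leqP t (size s); first by apply: H; rewrite mem_iota.
by rewrite take_oversize ?(ltnW st) // -(take_size s); apply: H; rewrite mem_iota /=.
Qed.

Lemma hook_word_rcons (s : seq nat) (a : nat) :
  hook_word (rcons s a) = hook_word s && admissible (rcons s a).
Proof.
rewrite /hook_word size_rcons -[X in iota 0 X]addn1 iotaD all_cat /= andbT.
rewrite [X in _ && admissible X]take_oversize ?size_rcons //; congr (_ && _).
rewrite !take0; congr (_ && _).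
apply: eq_in_all => t; rewrite mem_iota add1n ltnS => /andP[_ ts].
by rewrite -cats1 takel_cat.
Qed.

Lemma hook_word_admissible (s : seq nat) : hook_word s -> admissible s.
Proof. by move/hook_wordP/(_ (size s)); rewrite take_size. Qed.

Lemma count012 (n : nat) (w : n.-tuple 'I_3) :
  count_mem 0 (map val w) + count_mem 1 (map val w) + count_mem 2 (map val w) = n.
Proof.
rewrite -[RHS](size_tuple w) -(size_map val).
have: all (fun a => a < 3) (map val w) by apply/allP => _ /mapP[a _ ->] /=; apply: ltn_ord.
elim: (map val w) => //= a s IH /andP[a3 /IH <-].
by case: a a3 => [|[|[|a]]] //= _; lia.
Qed.

Lemma sum_tuple_rcons (T : finType) (n : nat) (F : seq T -> nat) :
  \sum_(w : n.+1.-tuple T) F w = \sum_(w : n.-tuple T) \sum_(a : T) F (rcons w a).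
Proof.
rewrite pair_big /=.
rewrite (reindex (fun p : n.-tuple T * T => [tuple of rcons p.1 p.2])) //=.
apply: onW_bij; apply: inj_card_bij.
  move=> [u a] [v b] /(congr1 val) /= /rcons_inj[uv ->].
  by congr (_, _); apply: val_inj.
by rewrite card_prod !card_tuple expnSr.
Qed.

(* Appending a letter to a word moves k by +1, -1 or 0, and 0 is forbidden
   exactly for the word of zeros: Motzkin paths without level steps before the
   first down step. *)
Definition num_words (n k : nat) : nat :=
  \sum_(w : n.-tuple 'I_3)
    (hook_word (map val w) && (count_mem 0 (map val w) == k + count_mem 1 (map val w))).

Lemma sum_tuple0 (T : finType) (F : seq T -> nat) :
  \sum_(w : 0.-tuple T) F w = F [::].
Proof.
rewrite (bigD1 [tuple]) //= big1 ?addn0 // => w /eqP[]; exact: tuple0.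
Qed.

Lemma num_words0 (k : nat) : num_words 0 k = (k == 0).
Proof.
rewrite /num_words (sum_tuple0 (fun w => (hook_word (map val w) && (count_mem 0 (map val w) == k + count_mem 1 (map val w))) : nat)) /=.
by rewrite addn0 eq_sym.
Qed.

(** Without a letter 1 admissibility excludes the letter 2, so only the word of zeros remains. *)
Lemma num_zero_words (n : nat) :
  \sum_(w : n.-tuple 'I_3) (hook_word (map val w) && (count_mem 1 (map val w) == 0)) = 1.
Proof.
elim: n => [|n IH].
  by rewrite (sum_tuple0 (fun w => (hook_word (map val w) && (count_mem 1 (map val w) == 0)) : nat)).
rewrite (sum_tuple_rcons _ (fun w => (hook_word (map val w) && (count_mem 1 (map val w) == 0)) : nat)).
rewrite -[RHS]IH; apply: eq_bigr => w _; rewrite !big_ord_recl big_ord0 /=.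
rewrite !map_rcons !hook_word_rcons.
have [hw|] //= := boolP (hook_word _).
move/hook_word_admissible: hw; rewrite /admissible -!cats1 !count_cat /=.
lia.
Qed.

(** The excluded extension of the zero word by 2 is added back on the left; both sides then become
    sums over words [w] that agree for each [w]. *)
Lemma num_wordsS (n k : nat) :
  num_words n.+1 k + (k == n) =
  (if k is k'.+1 then num_words n k' else 0) + num_words n k + num_words n k.+1.
Proof.
have -> : (k == n : nat) =
   \sum_(w : n.-tuple 'I_3) (hook_word (map val w) && (count_mem 1 (map val w) == 0) && (k == n)).
  case: (k == n); last by rewrite big1 // => w _; rewrite andbF.
  by rewrite -[LHS](num_zero_words n); apply: eq_bigr => w _; rewrite andbT.
rewrite {1}/num_words (sum_tuple_rcons _ (fun w => (hook_word (map val w) && (count_mem 0 (map val w) == k + count_mem 1 (map val w))) : nat)).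
have -> : (if k is k'.+1 then num_words n k' else 0) =
   \sum_(w : n.-tuple 'I_3) (hook_word (map val w) && (0 < k) && (count_mem 0 (map val w) == k.-1 + count_mem 1 (map val w))).
  case: k => [|k]; first by rewrite big1 // => w _; rewrite andbF.
  by apply: eq_bigr => w _; rewrite andbT.
rewrite -!big_split; apply: eq_bigr => w _; rewrite !big_ord_recl big_ord0 /=.
rewrite !map_rcons !hook_word_rcons.
have [hw|] //= := boolP (hook_word _).
move/hook_word_admissible: hw (count012 w); rewrite /admissible -!cats1 !count_cat /=.
lia.
Qed.

(** * Tableaux of hook shape *)

(* Position in [s] of the occurrence number [i] (counted from 0) of [a]; the
   value is junk when [a] occurs at most [i] times. *)
Fixpoint position (a i : nat) (s : seq nat) : nat :=
  if s is b :: s' then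
    if b == a then (if i is i'.+1 then (position a i' s').+1 else 0)
    else (position a i s').+1
  else 0.

(** Translates inequalities between tableau entries into letter counts of prefixes, in terms of
    which [admissible] is defined. *)
Lemma position_lt (a i : nat) (s : seq nat) (t : nat) :
  i < count_mem a s -> (position a i s < t) = (i < count_mem a (take t s)).
Proof.
elim: s i t => //= b s IH i [|t]; first by rewrite !ltn0.
rewrite /=; have [_|_] := eqVneq b a; last by rewrite !add0n ltnS; apply: IH.
by case: i => [|i] // ilt; rewrite !add1n !ltnS; apply: IH.
Qed.

Lemma position_lt_size (a i : nat) (s : seq nat) : i < count_mem a s -> position a i s < size s.
Proof. by move=> H; rewrite position_lt // take_size. Qed.

Lemma nth_position (a i : nat) (s : seq nat) : i < count_mem a s -> nth 0 s (position a i s) = a.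
Proof.
elim: s i => //= b s IH i.
have [->|_] := eqVneq b a; last by rewrite add0n => /IH.
by case: i => [|i] //=; rewrite add1n ltnS => /IH.
Qed.

Lemma count_take_position (a i : nat) (s : seq nat) :
  i < count_mem a s -> count_mem a (take (position a i s) s) = i.
Proof.
elim: s i => //= b s IH i.
have [->|ba] := eqVneq b a; last by rewrite add0n /= (negbTE ba) add0n => /IH.
by case: i => [|i] //=; rewrite eqxx !add1n ltnS => /IH ->.
Qed.

(** With [nth_position] and [count_take_position], an index and its pair (letter, occurrence number)
    determine each other. *)
Lemma position_count_take (s : seq nat) (v : nat) : v < size s ->
  position (nth 0 s v) (count_mem (nth 0 s v) (take v s)) s = v.
Proof.
elim: s v => //= b s IH [|v] /=; first by rewrite eqxx.
rewrite ltnS => /IH E.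
by have [_|_] := eqVneq b (nth 0 s v); rewrite ?add1n ?add0n E.
Qed.

Lemma ltn_count_take (s : seq nat) (v : nat) : v < size s ->
  count_mem (nth 0 s v) (take v s) < count_mem (nth 0 s v) s.
Proof.
move=> vs; have := count_cat (pred1 (nth 0 s v)) (take v s) (drop v s).
by rewrite cat_take_drop (drop_nth 0 vs) /= eqxx => ->; lia.
Qed.

Lemma count_take_sum (a t : nat) (n : nat) (w : n.-tuple 'I_3) :
  count_mem a (take t (map val w)) = \sum_(v < n) ((v < t) && (val (tnth w v) == a)).
Proof.
have -> : \sum_(v < n) ((v < t) && (val (tnth w v) == a)) =
          \sum_(0 <= v < n) ((v < t) && (nth 0 (map val w) v == a)).
  rewrite big_mkord; apply: eq_bigr => v _.
  by rewrite (tnth_nth ord0) (nth_map ord0) ?size_tuple.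
rewrite -[X in \sum_(0 <= v < X) _](size_tuple w) -(size_map val).
elim: (map val w) t => [|b s IH] [|t]; [by rewrite big_geq|by rewrite big_geq| |].
  by rewrite big1.
by rewrite big_nat_recl //= IH.
Qed.

(** * Cells of a hook shape by letter and rank *)

Definition hook_shape (n : nat) (la : n.-tuple 'I_n.+1) : bool :=
  is_partition la && hook21 la.

(* A cell of a hook shape is encoded by a letter, its row with all rows from the
   third on identified, and its rank among the cells with that letter. *)
Definition letter (n : nat) (la : n.-tuple 'I_n.+1) (x : cell la) : nat :=
  minn (val x).1 2.

Definition rank (n : nat) (la : n.-tuple 'I_n.+1) (x : cell la) : nat :=
  if (val x).1 < 2 then ((val x).2 : nat) else (val x).1 - 2.

Definition content (n : nat) (la : n.-tuple 'I_n.+1) (a : nat) : nat :=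
  match a with
  | 0 => part la 0
  | 1 => part la 1
  | 2 => n - part la 0 - part la 1
  | _ => 0
  end.

Lemma part_le (n : nat) (la : n.-tuple 'I_n.+1) (i : nat) : part la i <= n.
Proof.
rewrite /part; have [il|] := ltnP i n; last by move=> H; rewrite nth_default // size_map size_tuple.
by rewrite (nth_map ord0) ?size_tuple // -ltnS ltn_ord.
Qed.

Lemma part_default (n : nat) (la : n.-tuple 'I_n.+1) (i : nat) : n <= i -> part la i = 0.
Proof. by move=> H; rewrite /part nth_default // size_map size_tuple. Qed.

Lemma sumn_part (n : nat) (la : n.-tuple 'I_n.+1) :
  sumn (map val la) = \sum_(0 <= i < n) part la i.
Proof. by rewrite sumnE (big_nth 0) size_map size_tuple. Qed.

Lemma part_noninc (n : nat) (la : n.-tuple 'I_n.+1) (i : nat) :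
  is_partition la -> part la i.+1 <= part la i.
Proof.
move=> /andP[so _]; have [il|] := ltnP i.+1 n; last by move=> H; rewrite part_default.
have tr : transitive geq by move=> x y z /= xy zx; apply: leq_trans zx xy.
apply: (sorted_leq_nth tr leqnn 0 so); rewrite ?inE ?size_map ?size_tuple //.
exact: ltnW.
Qed.

Lemma hook_part (n : nat) (la : n.-tuple 'I_n.+1) (i : nat) : hook21 la -> 1 < i -> i < n ->
  part la i = (i < 2 + content la 2).
Proof.
move=> /forallP H i1 il; have /implyP/(_ i1)/eqP -> := H (Ordinal il).
by rewrite /=; case: ifP.
Qed.

Lemma sum_ltn (m n : nat) : m <= n -> \sum_(0 <= i < n) (i < m) = m.
Proof.
move=> mn; rewrite (@big_cat_nat _ _ _ m) //= [X in _ + X]big_nat [X in _ + X]big1 ?addn0.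
  by rewrite (eq_big_nat _ _ (F2 := fun=> 1)) ?sum_nat_const_nat ?subn0 ?muln1 // => i /andP[_ ->].
by move=> i /andP[H _]; rewrite ltnNge H.
Qed.

Lemma sumn_part2 (n : nat) (la : n.-tuple 'I_n.+1) : 1 < n ->
  sumn (map val la) = part la 0 + (part la 1 + \sum_(2 <= i < n) part la i).
Proof. by move=> n1; rewrite sumn_part big_ltn ?(ltnW n1) // big_ltn. Qed.

Lemma content_sum (n : nat) (la : n.-tuple 'I_n.+1) : hook_shape la -> 1 < n ->
  content la 0 + content la 1 + content la 2 = n.
Proof.
move=> /andP[/andP[_ /eqP S] _] n1; move: S; rewrite sumn_part2 // => S.
by rewrite /content addnC -subnDA subnK // -[X in _ <= X]S addnA leq_addr.
Qed.

(** The parts from the third on sum to [content la 2]; there are [n - 2] of them, each at most 1. *)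
Lemma content2_le (n : nat) (la : n.-tuple 'I_n.+1) : hook_shape la -> 1 < n ->
  2 + content la 2 <= n.
Proof.
move=> hs n1; have := content_sum hs n1.
move/andP: hs => [/andP[_ /eqP S] H]; move: S; rewrite sumn_part2 // => S.
have E : \sum_(2 <= i < n) part la i <= n - 2.
  rewrite (eq_big_nat _ _ (F2 := fun i => (i < 2 + content la 2) : nat)).
    rewrite -[X in _ <= X]muln1 -(sum_nat_const_nat 2 n 1).
    by apply: leq_sum => i _; apply: leq_b1.
  by move=> i /andP[i2 il]; apply: hook_part.
move: S E; rewrite /content; set c := \sum_(_ <= _ < _) _; lia.
Qed.

Lemma content10 (n : nat) (la : n.-tuple 'I_n.+1) : hook_shape la ->
  content la 1 <= content la 0.
Proof. by move=> /andP[P _]; apply: part_noninc. Qed.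

Lemma content21 (n : nat) (la : n.-tuple 'I_n.+1) : hook_shape la -> 1 < n ->
  0 < content la 2 -> 0 < content la 1.
Proof.
move=> hs n1 m0; have mle := content2_le hs n1; move/andP: hs => [P H].
apply: leq_trans (part_noninc 1 P); rewrite (hook_part H) //; lia.
Qed.

Lemma cell_row2 (n : nat) (la : n.-tuple 'I_n.+1) (x : cell la) : hook21 la ->
  1 < (val x).1 -> ((val x).2 = 0 :> nat) /\ (val x).1 < 2 + content la 2.
Proof.
move=> H r1; have := valP x; rewrite (hook_part H r1 (ltn_ord _)).
by case: (_ < 2 + content la 2) => /= c1; split=> //; lia.
Qed.

Lemma letter_lt3 (n : nat) (la : n.-tuple 'I_n.+1) (x : cell la) : letter x < 3.
Proof. rewrite /letter; lia. Qed.

Lemma rank_lt (n : nat) (la : n.-tuple 'I_n.+1) (x : cell la) : hook21 la ->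
  rank x < content la (letter x).
Proof.
move=> H; rewrite /rank /letter; have := valP x.
have := cell_row2 (x := x) H.
case: (val x) => [[r rn] [c cn]] /=.
case: r rn => [|[|r]] rn //= /(_ isT)[_ h]; rewrite /minn /=; lia.
Qed.

Lemma cell_exists (n : nat) (la : n.-tuple 'I_n.+1) (a i : nat) : hook_shape la -> 1 < n ->
  i < content la a -> exists2 x : cell la, letter x = a & rank x = i.
Proof.
move=> hs n1 ia.
have c2 := content2_le hs n1; have /andP[P H] := hs.
have mk r c (Hc : c < part la r) (rn : r < n) : exists x : cell la, (val x).1 = r :> nat /\ (val x).2 = c :> nat.
  have cn : c < n := leq_trans Hc (part_le _ _).
  by exists (exist (fun c : 'I_n * 'I_n => c.2 < part la c.1) (Ordinal rn, Ordinal cn) Hc).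
case: a ia => [|[|[|a]]] //= ia.
- have [|x [E1 E2]] := mk 0 i ia; first lia.
  by exists x; rewrite /letter /rank E1.
- have [|x [E1 E2]] := mk 1 i ia; first lia.
  by exists x; rewrite /letter /rank E1.
- have ih : i.+2 < 2 + content la 2 by [].
  have il : i.+2 < n := leq_trans ih c2.
  have [||x [E1 E2]] := mk i.+2 0 => //; first by rewrite (hook_part H) // ih.
  by exists x; rewrite /letter /rank E1 //= subn2.
Qed.

Lemma cell_inj (n : nat) (la : n.-tuple 'I_n.+1) (x y : cell la) : hook21 la ->
  letter x = letter y -> rank x = rank y -> x = y.
Proof.
move=> H; rewrite /letter /rank => E1 E2; apply: val_inj.
have := cell_row2 (x := x) H; have := cell_row2 (x := y) H.
move: E1 E2; case: (val x) => r c; case: (val y) => r' c' /= E1 E2 h h'.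
have Er : r = r' by apply: val_inj => /=; move: E1 E2; do 2! case: ifP; lia.
subst r'; congr (_, _); apply: val_inj => /=; move: E2; case: ifP => // rn _.
have r1 : 1 < r by lia.
by have [-> _] := h r1; have [-> _] := h' r1.
Qed.

(** Induction on [i]: by [cell_exists] and [cell_inj] exactly one cell is added, the one of rank
    [i]. *)
Lemma sum_cells_rank (n : nat) (la : n.-tuple 'I_n.+1) (a i : nat) : hook_shape la -> 1 < n ->
  i <= content la a ->
  \sum_(x : cell la) ((letter x == a) && (rank x < i)) = i.
Proof.
move=> hs n1; elim: i => [|i IH] ia; first by rewrite big1 // => x _; rewrite andbF.
rewrite -[RHS]addn1 -{2}(IH (ltnW ia)).
have [z lz rz] := cell_exists hs n1 ia.
have -> : 1 = \sum_(x : cell la) (x == z).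
  by rewrite (bigD1 z) //= eqxx big1 // => x /negbTE ->.
rewrite -big_split; apply: eq_bigr => x _ /=.
have [->|xz] := eqVneq x z; first by rewrite lz rz eqxx; lia.
have : (letter x == a) && (rank x == i) = false.
  apply/negP => /andP[/eqP lx /eqP rx]; case/eqP: xz.
  by apply: cell_inj; rewrite ?lz ?rz //; case/andP: hs.
lia.
Qed.

Lemma sum_cells_letter (n : nat) (la : n.-tuple 'I_n.+1) (a : nat) : hook_shape la -> 1 < n ->
  \sum_(x : cell la) (letter x == a) = content la a.
Proof.
move=> hs n1; rewrite -(sum_cells_rank hs n1 (leqnn _)); apply: eq_bigr => x _.
have [<-|] //= := eqVneq (letter x) a.
by rewrite rank_lt //; case/andP: hs.
Qed.

Lemma card_cell (n : nat) (la : n.-tuple 'I_n.+1) : hook_shape la -> 1 < n ->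
  #|cell la| = n.
Proof.
move=> hs n1; rewrite -[RHS](content_sum hs n1) -!(sum_cells_letter _ hs n1).
rewrite -!big_split -sum1_card; apply: eq_bigr => x _ /=.
have := letter_lt3 x; lia.
Qed.

(** Increase along ranks is a row condition for letters 0 and 1 and a column condition for letter 2.
    The other column conditions follow by transitivity from row 0 against row 1 and from the first
    cells of letters 1 and 2. *)
Lemma standardP (n : nat) (la : n.-tuple 'I_n.+1) (T : {ffun cell la -> 'I_n}) :
  hook_shape la -> 1 < n ->
  reflect
    [/\ injective T,
        forall x y, letter x = letter y -> rank x < rank y -> T x < T y,
        forall x y, letter x = 0 -> letter y = 1 -> rank x = rank y -> T x < T y
      & forall x y, letter x = 1 -> letter y = 2 -> rank x = 0 -> rank y = 0 -> T x < T y]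
    (standard T).
Proof.
move=> hs n1; have /andP[P H] := hs.
apply: (iffP and3P) => [[/injectiveP Ti /forallP R /forallP C]|[Ti S1 S2 S3]].
  have {}R (x y : cell la) : (val x).1 = (val y).1 -> (val x).2 < (val y).2 -> T x < T y.
    by move=> e l; have /forallP/(_ y)/implyP := R x; apply; rewrite e eqxx.
  have {}C (x y : cell la) : (val x).2 = (val y).2 :> nat -> (val x).1 < (val y).1 -> T x < T y.
    by move=> /val_inj e l; have /forallP/(_ y)/implyP := C x; apply; rewrite e eqxx.
  split=> // x y; have := cell_row2 (x := x) H; have := cell_row2 (x := y) H;
    rewrite /letter /rank => h h'.
  - have [r1|r1] := ltnP (val x).1 2 => E.
      have Er : (val x).1 = (val y).1 by apply: ord_inj; lia.
      by rewrite -Er r1; apply: R.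
    rewrite [X in _ < X]ifF; last lia.
    have y1 : 1 < (val y).1 by lia.
    have [cy _] := h y1; have [cx _] := h' r1.
    by move=> l; apply: C; [rewrite cx cy|lia].
  - move=> ex ey; rewrite !ifT; try lia.
    by move=> e; apply: C => //; lia.
  - move=> ex ey; rewrite ifT; last lia.
    have y1 : 1 < (val y).1 by lia.
    by have [cy _] := h y1; move=> cx _; apply: C; lia.
split; first exact/injectiveP.
  apply/forallP => x; apply/forallP => y; apply/implyP => /andP[/eqP e l].
  apply: S1; rewrite /letter /rank e //; case: (ltnP (val y).1 2) => // r1.
  have [y0 _] := cell_row2 H r1.
  by rewrite y0 in l.
apply/forallP => x; apply/forallP => y; apply/implyP => /andP[/eqP e l].
(* The first cell [v] of letter 2 bounds the entries of its letter from below. *)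
have S23 (z u : cell la) : letter z = 1 -> rank z = 0 -> letter u = 2 -> T z < T u.
  move=> lz rz lu; have ru := rank_lt u H; rewrite lu in ru.
  have [v lv rv] := cell_exists hs n1 (leq_ltn_trans (leq0n _) ru).
  have zv := S3 z v lz lv rz rv.
  have [u0|u0] := posnP (rank u).
    by rewrite (cell_inj (x := u) (y := v)) ?lu ?lv ?u0 ?rv.
  by apply: ltn_trans zv _; apply: S1; rewrite ?lv ?rv.
have := cell_row2 (x := y) H.
have [r2|r2] := ltnP 1 (val y).1 => [/(_ isT)[cy _]|_]; last first.
  by apply: S2; rewrite /letter /rank ?e ?ifT //; lia.
have ly : letter y = 2 by rewrite /letter; lia.
have [x2|x2] := ltnP 1 (val x).1.
  apply: S1; rewrite /letter /rank; first lia.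
  by rewrite !ifF; lia.
have [x1|x1] := ltnP 0 (val x).1.
  by apply: S23 => //; rewrite /letter /rank ?ifT ?e //; lia.
(* From row 0 to a row below row 1, the comparison passes through the first cell [z] of row 1. *)
have ry := rank_lt y H; rewrite ly in ry.
have [z lz rz] := cell_exists hs n1 (content21 hs n1 (leq_ltn_trans (leq0n _) ry)).
apply: ltn_trans (S23 z y lz rz ly); apply: S2 => //; rewrite ?rz /letter /rank; first lia.
by move/(congr1 (@nat_of_ord n)): e => e; rewrite ifT; lia.
Qed.

(** * Tableaux and the words they read *)

Definition fits (n : nat) (la : n.-tuple 'I_n.+1) (s : seq nat) : bool :=
  (count_mem 0 s == part la 0) && (count_mem 1 s == part la 1).

Lemma fits_content (n : nat) (la : n.-tuple 'I_n.+1) (w : n.-tuple 'I_3) (a : nat) :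
  hook_shape la -> 1 < n -> fits la (map val w) -> count_mem a (map val w) = content la a.
Proof.
move=> hs n1 /andP[/eqP c0 /eqP c1].
have := content_sum hs n1; have := count012 w; rewrite /content.
case: a => [|[|[|a]]] //; first lia.
by move=> _ _; apply/count_memPn/negP => /mapP[[b blt] _ /= e]; rewrite -e in blt.
Qed.

Lemma count_take_le (a t : nat) (s : seq nat) : count_mem a (take t s) <= count_mem a s.
Proof. by rewrite -[X in _ <= count _ X](cat_take_drop t s) count_cat leq_addr. Qed.

Definition reads (n : nat) (la : n.-tuple 'I_n.+1) (s : seq nat) (T : {ffun cell la -> 'I_n}) :=
  forall x, T x = position (letter x) (rank x) s :> nat.

(** By [position_lt], the inequalities between letters 0 and 1 say that no prefix has more 1s than
    0s, and those between letters 1 and 2 that no 2 precedes the first 1. *)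
Lemma reads_standard (n : nat) (la : n.-tuple 'I_n.+1) (w : n.-tuple 'I_3)
    (T : {ffun cell la -> 'I_n}) :
  hook_shape la -> 1 < n -> fits la (map val w) -> reads (map val w) T ->
  standard T = hook_word (map val w).
Proof.
move=> hs n1 /(fits_content _ hs n1); move: (map val w) => s M R.
have /andP[_ H] := hs.
have rl (x : cell la) : rank x < count_mem (letter x) s by rewrite M rank_lt.
have Tlt (x : cell la) t : (T x < t) = (rank x < count_mem (letter x) (take t s)).
  by rewrite R position_lt.
apply/(sameP (standardP T hs n1)); apply: (iffP (hook_wordP _)) => [A|[_ _ S2 S3] t].
  have lT (x : cell la) : letter x = nth 0 s (T x) by rewrite R nth_position.
  have rT (x : cell la) : rank x = count_mem (letter x) (take (T x) s) by rewrite R count_take_position.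
  have Ti : injective T.
    by move=> x y e; apply: cell_inj => //; rewrite ?rT lT e // -lT.
  (* Cells with different letters have different entries, so it suffices to look at the prefix that
     ends with the letter of [y]. *)
  have Tle (x y : cell la) : letter x <> letter y -> T x < (T y).+1 -> T x < T y.
    rewrite ltnS leq_eqVlt => ne /orP[/eqP e|//].
    by case: ne; rewrite !lT e.
  have Ty (y : cell la) : rank y < count_mem (letter y) (take (T y).+1 s) by rewrite -Tlt.
  split=> // [x y e|x y lx ly e|x y lx ly rx ry].
  - by rewrite Tlt e -rT.
  - apply: Tle; first by rewrite lx ly.
    have /andP[A1 _] := A (T y).+1.
    by rewrite Tlt lx e; apply: leq_trans A1; rewrite -ly.
  - apply: Tle; first by rewrite lx ly.
    have /andP[_ /implyP A2] := A (T y).+1.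
    by rewrite Tlt lx rx; apply: A2; have := Ty y; rewrite ly ry.
apply/andP; split.
  (* If a prefix had [m] zeros and more ones, it would contain the entry of the letter-1 cell of
     rank [m], hence also that of the letter-0 cell of rank [m], an extra zero. *)
  rewrite leqNgt; apply/negP; set m := count_mem 0 _ => mlt.
  have m1 : m < content la 1 by rewrite -M; apply: leq_trans mlt (count_take_le _ _ _).
  have [y ly ry] := cell_exists hs n1 m1.
  have [x lx rx] := cell_exists hs n1 (leq_trans m1 (content10 hs)).
  have : T x < t by apply: ltn_trans (S2 x y lx ly _) _; rewrite ?rx ?ry // Tlt ly ry.
  by rewrite Tlt lx rx ltnn.
apply/implyP => c2.
have m2 : 0 < content la 2 by rewrite -M; apply: leq_trans c2 (count_take_le _ _ _).
have [y ly ry] := cell_exists hs n1 m2.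
have [x lx rx] := cell_exists hs n1 (content21 hs n1 m2).
have : T x < t by apply: ltn_trans (S3 x y lx ly rx ry) _; rewrite Tlt ly ry.
by rewrite Tlt lx rx.
Qed.

(** The default [(val x).1] is just some element of ['I_n]; for a fitting word and a hook shape with
    [1 < n] the position is below [n]. *)
Definition filling (n : nat) (la : n.-tuple 'I_n.+1) (s : seq nat) : {ffun cell la -> 'I_n} :=
  [ffun x : cell la => insubd (val x).1 (position (letter x) (rank x) s)].

Lemma filling_reads (n : nat) (la : n.-tuple 'I_n.+1) (w : n.-tuple 'I_3) :
  hook_shape la -> 1 < n -> fits la (map val w) -> reads (map val w) (filling la (map val w)).
Proof.
move=> hs n1 /(fits_content _ hs n1) M x; have /andP[_ H] := hs.
rewrite ffunE insubdK // -topredE /=.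
by rewrite -[X in _ < X](size_tuple w) -(size_map val) position_lt_size // M rank_lt.
Qed.

(** The letter of either word at index [v] is the letter of the cell whose entry is [v]. *)
Lemma reads_inj (n : nat) (la : n.-tuple 'I_n.+1) (w w' : n.-tuple 'I_3)
    (T : {ffun cell la -> 'I_n}) :
  hook_shape la -> 1 < n -> fits la (map val w) -> fits la (map val w') ->
  reads (map val w) T -> reads (map val w') T -> w = w'.
Proof.
move=> hs n1 /(fits_content _ hs n1) M /(fits_content _ hs n1) M' R R'.
have /andP[_ H] := hs.
apply: eq_from_tnth => v; apply: val_inj.
have E (u : n.-tuple 'I_3) : val (tnth u v) = nth 0 (map val u) v.
  by rewrite (tnth_nth (tnth u v)) (nth_map (tnth u v)) ?size_tuple.
rewrite !E; have vs : v < size (map val w) by rewrite size_map size_tuple.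
have := ltn_count_take vs; rewrite M => /(cell_exists hs n1)[x lx rx].
have Tv : T x = v :> nat by rewrite R lx rx position_count_take.
by rewrite -{2}Tv R' nth_position ?lx // M' -lx rank_lt.
Qed.

(** The word lists the letters of the cells by increasing entry. Within a letter, entries increase
    with rank, so [rank x] copies of that letter precede index [T x]. *)
Lemma standard_reads (n : nat) (la : n.-tuple 'I_n.+1) (T : {ffun cell la -> 'I_n}) :
  hook_shape la -> 1 < n -> standard T ->
  exists2 w : n.-tuple 'I_3, fits la (map val w) & reads (map val w) T.
Proof.
move=> hs n1 /(standardP T hs n1)[Ti S1 _ _]; have /andP[_ H] := hs.
have Tb : bijective T by apply: inj_card_bij; rewrite // card_ord card_cell.
have [g gT Tg] := Tb.
pose w := [tuple inord (letter (g v)) : 'I_3 | v < n].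
have wT x : val (tnth w (T x)) = letter x.
  by rewrite tnth_mktuple gT /= inordK // letter_lt3.
have cT a t : count_mem a (take t (map val w)) = \sum_(x : cell la) ((T x < t) && (letter x == a)).
  rewrite count_take_sum (reindex T) /=; last exact: onW_bij.
  by apply: eq_bigr => x _; rewrite wT.
have sw : size (map val w) = n by rewrite size_map size_tuple.
have cn a : count_mem a (map val w) = content la a.
  rewrite -(take_size (map val w)) sw cT -(sum_cells_letter a hs n1).
  by apply: eq_bigr => x _; rewrite ltn_ord.
exists w; first by rewrite /fits !cn !eqxx.
move=> x; rewrite -[LHS](@position_count_take (map val w)); last by rewrite sw.
have -> : nth 0 (map val w) (T x) = letter x.
  by rewrite -wT (tnth_nth ord0) (nth_map ord0) // size_tuple.
congr (position _ _ _); rewrite cT -[RHS](@sum_cells_rank _ la (letter x)) //; last first.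
  exact/ltnW/rank_lt.
apply: eq_bigr => y _; rewrite andbC; have [e|] //= := eqVneq (letter y) (letter x).
congr nat_of_bool; apply/idP/idP => [lT|]; last exact: S1.
rewrite ltnNge leq_eqVlt; apply/negP => /orP[/eqP r|r].
  by rewrite (cell_inj (x := x) (y := y)) // ltnn in lT.
by have := ltn_trans lT (S1 x y (esym e) r); rewrite ltnn.
Qed.

Lemma card_SYT (n : nat) (la : n.-tuple 'I_n.+1) : hook_shape la -> 1 < n ->
  #|SYT la| = \sum_(w : n.-tuple 'I_3) (hook_word (map val w) && fits la (map val w)).
Proof.
move=> hs n1; pose W := [set w : n.-tuple 'I_3 | hook_word (map val w) && fits la (map val w)].
have -> : SYT la = [set filling la (map val w) | w : n.-tuple 'I_3 in W].
  apply/setP => T; apply/idP/imsetP => [|[w]]; rewrite !inE.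
    move=> sT; have [w fw rw] := standard_reads hs n1 sT.
    exists w; first by rewrite inE -(reads_standard hs n1 fw rw) sT.
    by apply/ffunP => x; apply: val_inj; rewrite /= rw filling_reads.
  by move=> /andP[hw fw] ->; rewrite (reads_standard hs n1 fw) ?hw //; apply: filling_reads.
rewrite card_in_imset; last first.
  move=> w w'; rewrite !inE => /andP[_ fw] /andP[_ fw'] e.
  apply: (reads_inj hs n1 fw fw' (T := filling la (map val w))); first exact: filling_reads.
  by rewrite e; apply: filling_reads.
by rewrite -sum1_card big_mkcond; apply: eq_bigr => w _; rewrite inE; case: (_ && _).
Qed.

(** * The shape of a word, and summation over shapes *)

Definition word_shape (n : nat) (s : seq nat) : n.-tuple 'I_n.+1 :=
  [tuple inord (match val i with
                | 0 => count_mem 0 s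
                | 1 => count_mem 1 s
                | j => j < 2 + count_mem 2 s : nat
                end) | i < n].

Lemma part_word_shape (n : nat) (w : n.-tuple 'I_3) (i : nat) : i < n ->
  part (word_shape n (map val w)) i =
  match i with
  | 0 => count_mem 0 (map val w)
  | 1 => count_mem 1 (map val w)
  | j => j < 2 + count_mem 2 (map val w)
  end.
Proof.
move=> il; rewrite /part (nth_map ord0) ?size_tuple //.
rewrite -[i in LHS]/(val (Ordinal il)) -tnth_nth tnth_mktuple /=.
have /= := count012 w.
by case: i il => [|[|i]] il c; rewrite inordK //; lia.
Qed.

Lemma part_tnth (n : nat) (la : n.-tuple 'I_n.+1) (i : 'I_n) : part la i = val (tnth la i).
Proof. by rewrite /part (nth_map ord0) ?size_tuple // -tnth_nth. Qed.

Lemma hook_shape_word (n : nat) (w : n.-tuple 'I_3) : 1 < n -> hook_word (map val w) ->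
  hook_shape (word_shape n (map val w)).
Proof.
move=> n1 /hook_word_admissible/andP[c10 /implyP c21].
have c := count012 w; set la := word_shape _ _.
have p0 : part la 0 = count_mem 0 (map val w) by rewrite part_word_shape // ltnW.
have p1 : part la 1 = count_mem 1 (map val w) by rewrite part_word_shape.
have p2 i : 1 < i -> i < n -> part la i = (i < 2 + count_mem 2 (map val w)).
  by case: i => [|[|i]] // _ il; rewrite part_word_shape.
(* A letter 2 forces a 1 and hence a 0; without a letter 2 this is [1 < n]. *)
have c2n : 2 + count_mem 2 (map val w) <= n by lia.
apply/andP; split; last first.
  apply/forallP => i; apply/implyP => i2; rewrite p2 // p0 p1.
  have -> : n - count_mem 0 (map val w) - count_mem 1 (map val w) = count_mem 2 (map val w) by lia.
  by case: ifP.
apply/andP; split.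
  apply/(sortedP 0) => i; rewrite size_map size_tuple => il.
  change (part la i.+1 <= part la i); case: i il => [|[|i]] il.
  - by rewrite p0 p1.
  - rewrite p1 p2 //; lia.
  - rewrite !p2 ?(ltnW il) //; lia.
rewrite sumn_part2 // p0 p1 (eq_big_nat _ _ (F2 := fun i => (i < 2 + count_mem 2 (map val w)) : nat)).
  have := sum_ltn c2n; rewrite big_ltn ?(ltnW n1) // big_ltn //.
  by set S := \sum_(_ <= _ < _) _; lia.
by move=> i /andP[]; apply: p2.
Qed.

Lemma word_shape_unique (n : nat) (la : n.-tuple 'I_n.+1) (w : n.-tuple 'I_3) :
  1 < n -> hook_shape la -> fits la (map val w) -> la = word_shape n (map val w).
Proof.
move=> n1 hs fw; apply: eq_from_tnth => i; apply: val_inj.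
rewrite -!part_tnth part_word_shape //.
have M a := fits_content a hs n1 fw.
case: i => [[|[|i]] il] /=; rewrite !M // -(hook_part _ _ il) //.
by case/andP: hs.
Qed.

Lemma S21_num_words (n k : nat) : 1 < n -> S21 k n = num_words n k.
Proof.
move=> n1; rewrite /S21.
(* Once the shape is an indicator, the sums can be exchanged, and each word contributes at its own
   shape only. *)
transitivity (\sum_(la : n.-tuple 'I_n.+1) \sum_(w : n.-tuple 'I_3)
   ((la == word_shape n (map val w)) && (hook_word (map val w) &&
     (count_mem 0 (map val w) == k + count_mem 1 (map val w))))).
  rewrite big_mkcond; apply: eq_bigr => la _.
  (* The truncated difference is exact because a hook word has at least as many 0s as 1s. *)
  have key (w : n.-tuple 'I_3) : hook_shape la -> hook_word (map val w) -> fits la (map val w) ->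
     (part la 0 - part la 1 == k) = (count_mem 0 (map val w) == k + count_mem 1 (map val w)).
    move=> hs /hook_word_admissible/andP[c _] /andP[/eqP <- /eqP <-]; lia.
  have fitsE (w : n.-tuple 'I_3) : la = word_shape n (map val w) -> fits la (map val w).
    by move=> ->; rewrite /fits !part_word_shape ?eqxx // ltnW.
  case: ifP => [/and3P[P H /eqP kE]|nv].
    have hs : hook_shape la by rewrite /hook_shape P.
    rewrite card_SYT //; apply: eq_bigr => w _; congr nat_of_bool.
    apply/idP/idP => [/andP[hw fw]|/and3P[/eqP e hw _]].
      by rewrite hw -(key w) // kE eqxx (word_shape_unique n1 hs fw) eqxx.
    by rewrite hw fitsE.
  rewrite big1 // => w _; apply/eqP; rewrite eqb0; apply/negP => /and3P[/eqP e hw kE].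
  have hs : hook_shape la by rewrite e hook_shape_word.
  move: nv; rewrite (key w) ?fitsE // kE andbT.
  by move: hs; rewrite /hook_shape => ->.
rewrite exchange_big; apply: eq_bigr => w _ /=.
rewrite (bigD1 (word_shape n (map val w))) //= eqxx big1 ?addn0 // => la /negbTE -> //.
Qed.

(* Subtractions and halvings are those of nat. For k + 2 <= n and (i, j) in the
   range of summation with chi = 1 they are all exact, except that n - 2i - 2
   is -1 when k = 0, n = 2i + 1 (whence j = 0); the binomial coefficient is then
   binom(-1, 0) = 1 = 'C(0, 0). *)
Theorem theorem1p2 (n k : nat) (hkn : k + 2 <= n) :
  ((S21 k n)%:R = (-1) ^+ (n + k) +
     \sum_(0 <= i < (((n - k - 1) %/ 2).+1)%N)
       \sum_(0 <= j < ((n - k - 1 - 2 * i).+1)%N)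
         chi (j == n + k - 1 %[mod 2])%N *
         ((2 * k + 2)%N%:R / (n + k + 1 - 2 * i - j)%N%:R) *
         'C(n - 2 * i - 2, j)%:R *
         'C(n - 2 * i - j - 1, (n + k - j - 1) %/ 2 - i)%:R :> rat)%R.
Proof.
have n1 : 1 < n by lia.
have kn : k < n by lia.
rewrite S21_num_words // -motzkin_nonlevel_sum_formula //.
apply: (@motzkin_recurrence_solution (fun n k => (num_words n k)%:R)%R) (ltnW kn) => [i|m i].
  by rewrite num_words0.
(* The subtracted term moves to the other side, where [num_wordsS] adds it in [nat]. *)
apply/eqP; rewrite eq_sym subr_eq eq_sym -natrD num_wordsS /motzkin_step !natrD.
by case: i.
Qed.
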